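(* Let $f(x)=\sum_{i=0}^n a_i x^i\in\mathbb{Z}[x]$ be a polynomial of degree $n$ (so $a_n\neq 0$). Suppose that for some positive integer $k$ with $2k\leq n$ we have $a_na_i=a_0a_{n-i}$ for all $1\leq i\leq k-1$. Let $\alpha=|a_ka_n-a_0a_{n-k}|$. Then \[ M(f)\geq\frac{\alpha+\sqrt{\alpha^2+4(|a_0|+|a_n|)^2|a_0a_n|}}{2(|a_0|+|a_n|)}. \]
   Context: For a polynomial $f(x)=a_n(x-\alpha_1)(x-\alpha_2)\cdots(x-\alpha_n)$ with integer coefficients and leading coefficient $a_n$, the Mahler measure is $M(f)=|a_n|\prod_{i=1}^n\max\{1,|\alpha_i|\}$. *)

(* Defs.v *)
From mathcomp Require Import all_boot all_order all_algebra.
From mathcomp Require Import reals complex.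
Set Implicit Arguments.
Unset Strict Implicit.
Unset Printing Implicit Defensive.
Import Order.TTheory GRing.Theory Num.Theory.
Local Open Scope ring_scope.

(* Complex roots of f, listed with multiplicity; the empty list when f = 0. *)
Definition complex_roots (R : realType) (f : {poly int}) : seq R[i] :=
  if f == 0 then [::]
  else sval (closed_field_poly_normal (map_poly intr f : {poly R[i]})).

(* [normc] is the modulus with values in R; the norm `|z| on R[i] takes its
   values in R[i]. *)
Definition mahler_measure (R : realType) (f : {poly int}) : R :=
  `|lead_coef f|%:~R *
  \prod_(z <- complex_roots R f) Num.max 1 (Normc.normc z).

Lemma lead_coef_map_intr (R : realType) (f : {poly int}) :
  lead_coef (map_poly intr f : {poly R[i]}) = (lead_coef f)%:~R.
Proof.
by rewrite lead_coef_map_inj ?rmorph0 //; exact: intr_inj.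
Qed.

Lemma complex_rootsP (R : realType) (f : {poly int}) :
  map_poly intr f =
    (lead_coef f)%:~R *: \prod_(z <- complex_roots R f) ('X - z%:P).
Proof.
rewrite /complex_roots; case: eqP => [->|_].
  by rewrite lead_coef0 map_poly0 scale0r.
case: closed_field_poly_normal => s /= Es.
by rewrite {1}Es lead_coef_map_intr.
Qed.

(* The definition does not depend on the chosen enumeration of the roots. *)
Lemma mahler_measureE (R : realType) (f : {poly int}) (s : seq R[i]) :
  f != 0 ->
  map_poly intr f = (lead_coef f)%:~R *: \prod_(z <- s) ('X - z%:P) ->
  mahler_measure R f =
    `|lead_coef f|%:~R * \prod_(z <- s) Num.max 1 (Normc.normc z).
Proof.
move=> f0 Es; congr (_ * _); apply: perm_big; apply: prod_XsubC_eq.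
have l0 : (lead_coef f)%:~R != 0 :> R[i] by rewrite intr_eq0 lead_coef_eq0.
by apply: (scalerI l0); rewrite -Es -complex_rootsP.
Qed.

(* Main.v *)
Require Import Defs.
From mathcomp Require Import all_boot all_order all_algebra.
From mathcomp Require Import reals complex.
From mathcomp Require Import ring lra.
Set Implicit Arguments.
Unset Strict Implicit.
Unset Printing Implicit Defensive.
Import Order.TTheory GRing.Theory Num.Theory.
Local Open Scope ring_scope.

(* With f* the reciprocal polynomial, a_n f - a_0 f* starts with
   +-alpha X^k, so that f / f* = a_0 / a_n +- (alpha / a_n^2) X^k + ...
   Over the roots z, f / f* is the product of the Blaschke factors
   (X - z) / (1 - z^* X); the roots with |z| <= 1 give a power series
   F = c_0 + c_1 X + ..., the other ones give the inverse of a power series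
   G = d_0 + d_1 X + ..., with |c_0| = |a_0| / M(f) and |d_0| = |a_n| / M(f).
   Comparing coefficients of X^k in F = (f / f* ) G bounds alpha by |c_k| and
   |d_k|, and both are controlled by |c_k| <= 1 - |c_0|^2 (same for d).
   This last bound is proved without complex analysis: multiplication by a
   Blaschke factor is a contraction for the l^2 norm of truncated coefficient
   sequences, by a telescoping identity. *)

Definition trunc_norm2 (C : numClosedFieldType) (N : nat) (p : {poly C}) : C :=
  \sum_(i < N) `|p`_i| ^+ 2.

(* With p = (1 - a^* X) u and q = (X - a) u,
   |p_i|^2 - |q_i|^2 = (1 - |a|^2) (|u_i|^2 - |u_(i-1)|^2) telescopes. *)
Lemma trunc_norm2_blaschke (C : numClosedFieldType) (a : C) (u : {poly C}) m :
  trunc_norm2 m.+1 ((1 - a^* *: 'X) * u) - trunc_norm2 m.+1 (('X - a%:P) * u) =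
  (1 - `|a| ^+ 2) * `|u`_m| ^+ 2.
Proof.
rewrite /trunc_norm2; elim: m => [|m IHm].
  rewrite !big_ord_recl !big_ord0 !mulrBl mul1r -!scalerAl !coefB coefZ.
  rewrite mul_polyC !coefXM coefZ /= mulr0 subr0 sub0r normrN normrM.
  by rewrite exprMn !normCK; ring.
rewrite big_ord_recr [X in _ - X]big_ord_recr /= opprD addrACA IHm.
rewrite !mulrBl !mul1r -!scalerAl !coefB !coefZ !coefCM !coefXM /=.
by rewrite !normCK !rmorphB !rmorphM /= conjCK; ring.
Qed.

(** The factors are exchanged one at a time; each exchange is governed by the Blaschke identity,
    whose factor 1 - |z|^2 is nonnegative on the closed disc. *)
Lemma trunc_norm2_in (C : numClosedFieldType) (N : nat) (s : seq C)
    (u : {poly C}) :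
  all (fun z => `|z| <= 1) s ->
  trunc_norm2 N ((\prod_(z <- s) ('X - z%:P)) * u) <=
  trunc_norm2 N ((\prod_(z <- s) (1 - z^* *: 'X)) * u).
Proof.
case: N => [|N]; first by rewrite /trunc_norm2 !big_ord0.
elim: s u => [|z s IHs] u /=; first by rewrite !big_nil.
move=> /andP[z1 s1]; rewrite !big_cons -!mulrA.
apply: (@le_trans _ _ (trunc_norm2 N.+1
  ((1 - z^* *: 'X) * (\prod_(z <- s) ('X - z%:P) * u)))).
  rewrite -subr_ge0 trunc_norm2_blaschke mulr_ge0 ?exprn_ge0 //.
  by rewrite subr_ge0 expr_le1.
by rewrite mulrCA [in leRHS]mulrCA IHs.
Qed.

Lemma trunc_norm2_out (C : numClosedFieldType) (N : nat) (s : seq C)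
    (u : {poly C}) :
  all (fun z => 1 <= `|z|) s ->
  trunc_norm2 N ((\prod_(z <- s) (1 - z^* *: 'X)) * u) <=
  trunc_norm2 N ((\prod_(z <- s) ('X - z%:P)) * u).
Proof.
case: N => [|N]; first by rewrite /trunc_norm2 !big_ord0.
elim: s u => [|z s IHs] u /=; first by rewrite !big_nil.
move=> /andP[z1 s1]; rewrite !big_cons -!mulrA.
apply: (@le_trans _ _ (trunc_norm2 N.+1
  (('X - z%:P) * (\prod_(z <- s) (1 - z^* *: 'X) * u)))).
  rewrite -subr_le0 trunc_norm2_blaschke mulr_le0_ge0 ?exprn_ge0 //.
  by rewrite subr_le0 expr_ge1.
by rewrite mulrCA [in leRHS]mulrCA IHs.
Qed.

(** Such a [v] replaces the power series inverse of [p]; it is a Bezout coefficient, since [p] is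
    coprime to X. *)
Lemma poly_inv_modXn (F : fieldType) (N : nat) (p : {poly F}) :
  p`_0 != 0 -> exists v r : {poly F}, p * v = 1 + r * 'X^N.
Proof.
move=> p0.
have : coprimep p 'X^N.
  rewrite coprimep_expr // -[X in coprimep _ X]subr0 -(polyC0 F).
  by rewrite coprimep_XsubC /root horner_coef0.
move=> /Bezout_eq1_coprimepP[[v r] /= <-].
by exists v, (- r); rewrite mulNr addrK mulrC.
Qed.

(** The hypothesis says that the Toeplitz matrix with rows (c0, 0) and (ck, c0) is a contraction;
    well-chosen test vectors give the bound. *)
Lemma le_norm_toeplitz2 (C : numClosedFieldType) (c0 ck : C) :
  (forall x y, `|c0 * x| ^+ 2 + `|ck * x + c0 * y| ^+ 2 <=
               `|x| ^+ 2 + `|y| ^+ 2) ->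
  `|ck| <= 1 - `|c0| ^+ 2.
Proof.
move=> H; set t := 1 - `|c0| ^+ 2.
have c0E : `|c0| ^+ 2 = 1 - t by rewrite /t subKr.
have t0 : 0 <= t.
  have := H 0 1; rewrite !mulr0 add0r mulr1 normr0 normr1.
  rewrite expr0n expr1n /= !add0r.
  by rewrite subr_ge0.
have tN : `|t| = t by rewrite ger0_norm.
(* For t = 0 the test vector used further down yields nothing, but (1, 0) gives |c0|^2 + |ck|^2 <= 1
   and forces ck = 0. *)
have [tz|tnz] := eqVneq t 0.
  have := H 1 0; rewrite !mulr0 addr0 !mulr1 normr0 normr1.
  rewrite expr0n expr1n /= addr0.
  by rewrite addrC -lerBrDr -/t tz => h;
    rewrite -(ler_sqr (x := `|ck|)) ?nnegrE ?expr0n.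
have tgt : 0 < t by rewrite lt_neqAle eq_sym tnz.
(* The choice making [ck * x + c0 * y] equal to [ck]. *)
have := H t (c0^* * ck).
have -> : ck * t + c0 * (c0^* * ck) = ck.
  by rewrite mulrA -normCK c0E; ring.
rewrite !normrM norm_conjC tN !exprMn c0E => h.
have : `|ck| ^+ 2 * t <= t ^+ 2 * t.
  rewrite -subr_ge0; rewrite -subr_ge0 in h; apply: le_trans h _.
  by rewrite le_eqVlt; apply/orP; left; apply/eqP; ring.
by rewrite ler_pM2r // ler_sqr // nnegrE.
Qed.

(* Testing the contraction property on [v * (x + y X^k)] isolates the
   coefficients of degrees 0 and k of the quotient [p / q]. *)
Lemma schur_coef_bound (C : numClosedFieldType) (k : nat) (p q v r : {poly C}) :
  (0 < k)%N ->
  (forall u, trunc_norm2 k.+1 (p * u) <= trunc_norm2 k.+1 (q * u)) ->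
  q * v = 1 + r * 'X^(k.+1) ->
  `|(p * v)`_k| <= 1 - `|(p * v)`_0| ^+ 2.
Proof.
case: k => // k _ H qv; apply: le_norm_toeplitz2 => x y.
have H1 := H (v * (x%:P + y *: 'X^(k.+1))).
rewrite !mulrA qv in H1.
apply: le_trans (le_trans H1 _).
  rewrite /trunc_norm2 big_ord_recl big_ord_recr /= addrA.
  rewrite mulrDr -scalerAr !coefD !coefMC !coefZ !coefMXn /= mulr0 addr0.
  rewrite /bump /= add1n ltnn subnn [y * _]mulrC lerD2r lerDl.
  by apply: sumr_ge0 => i _; rewrite exprn_ge0.
rewrite /trunc_norm2 big_ord_recl big_ord_recr /= /bump /= add1n.
rewrite big1 => [|i _]; last first.
  rewrite mulrDl mul1r mulrAC coefD coefMXn ltnS /bump /= add1n.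
  rewrite (ltn_trans (ltn_ord i)) // addr0 coefD coefC coefZ coefXn /=.
  by rewrite eqSS (ltn_eqF (ltn_ord i)) mulr0 addr0 normr0 expr0n.
rewrite add0r mulrDl mul1r mulrAC !coefD !coefMXn !coefC !coefZ !coefXn /=.
by rewrite ltnSn eqxx mulr0 mulr1 !addr0 add0r.
Qed.

(** Each factor 1 - z^* X is X - z with coefficients reversed and conjugated, and both operations
    are multiplicative. The vanishing facts [sP] and [sQ] settle the boundary indices. *)
Lemma coef_conj_rev (C : numClosedFieldType) (s : seq C) i j :
  (i + j)%N = size s ->
  (\prod_(z <- s) (1 - z^* *: 'X))`_i = ((\prod_(z <- s) ('X - z%:P))`_j)^*.
Proof.
have sP (t : seq C) m : (size t < m)%N -> (\prod_(z <- t) ('X - z%:P))`_m = 0.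
  by move=> h; rewrite nth_default // size_prod_XsubC.
have sQ (t : seq C) m :
    (size t < m)%N -> (\prod_(z <- t) (1 - z^* *: 'X))`_m = 0.
  elim: t m => [|z t IH] [|m] //=; first by rewrite big_nil coefC.
  rewrite ltnS => h; rewrite big_cons mulrBl mul1r -scalerAl.
  rewrite coefB coefZ coefXM /=.
  by rewrite !IH // ?mulr0 ?subr0 // ltnW.
elim: s i j => [|z s IH] i j /=.
  by case: i => //; case: j => // _; rewrite !big_nil !coefC conjC1.
rewrite !big_cons !mulrBl mul1r -scalerAl !coefB coefZ mul_polyC coefZ !coefXM.
rewrite rmorphB rmorphM /=.
case: i => [|i]; case: j => [|j] //=;
  rewrite ?addSn ?addnS ?addn0 ?add0n => -[e].
- by rewrite (IH 0%N j) // (sP s j.+1) ?e // rmorph0 !mulr0.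
- by rewrite (IH i 0%N) ?addn0 // (sQ s i.+1) ?e // rmorph0.
- by rewrite (IH i.+1 j) ?(IH i j.+1) ?addSn ?addnS ?e.
Qed.

(* max(1, |z|) is spelled out because the order of C is only partial. *)
Lemma mahler_quadratic_bound (C : numClosedFieldType) (g : {poly C}) (s : seq C)
    k :
  let n := size s in
  let a0 := g`_0 in
  let an := g`_n in
  let beta := an * g`_k - a0 * g`_(n - k) in
  let M := `|an| * \prod_(z <- s) (if `|z| <= 1 then 1 else `|z|) in
  (0 < k <= n)%N -> an != 0 ->
  g = an *: \prod_(z <- s) ('X - z%:P) ->
  (forall i, g`_i \is Num.real) ->
  (forall i, (0 < i < k)%N -> an * g`_i = a0 * g`_(n - i)) ->
  `|beta| * M <= (`|a0| + `|an|) * (M ^+ 2 - `|a0| * `|an|).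
Proof.
move=> n a0 an beta M /andP[k0 kn] an0 gE g_real g_rec.
pose ins z : bool := `|z : C| <= 1.
pose si := filter ins s; pose so := filter (predC ins) s.
pose P (t : seq C) : {poly C} := \prod_(z <- t) ('X - z%:P).
pose Q (t : seq C) : {poly C} := \prod_(z <- t) (1 - z^* *: 'X).
have split_s : perm_eq (si ++ so) s by apply/permPl/perm_filterC.
have PE : P s = P si * P so by rewrite /P -(perm_big _ split_s) big_cat.
have QE : Q s = Q si * Q so by rewrite /Q -(perm_big _ split_s) big_cat.
have Q0 t : (Q t)`_0 = 1.
  rewrite -horner_coef0 horner_prod big1 // => z _.
  by rewrite !hornerE ?mulr0 ?subr0.
have P0 t : `|(P t)`_0| = \prod_(z <- t) `|z|.
  rewrite -horner_coef0 horner_prod normr_prod; apply: eq_bigr => z _.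
  by rewrite !hornerE ?sub0r ?add0r normrN.
pose c := \prod_(z <- si) `|z|; pose o := \prod_(z <- so) `|z|.
have o0 : o != 0.
  rewrite prodf_seq_neq0; apply/allP => z; rewrite mem_filter /= /ins normr_eq0.
  by move=> /andP[+ _]; apply: contra => /eqP ->; rewrite normr0 ler01.
have gcoef i : g`_i = an * (P s)`_i by rewrite {1}gE coefZ.
(* This is the reciprocal polynomial of [g]: the coefficients being real, the conjugation
   disappears. *)
pose g' := an *: Q s.
have g'E i : (i <= n)%N -> g'`_i = g`_(n - i).
  move=> le_in; rewrite coefZ (coef_conj_rev (j := n - i)) ?subnKC //.
  rewrite -[RHS]conj_Creal //.
  rewrite gcoef rmorphM /= [an^*]conj_Creal //; exact: g_real.
(* Up to degree k, [P si * Vi] and [Q so * Vo] are the power series F and G; [o0] makes [P so]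
   invertible. *)
have [Vi [ri Vi1]] : exists v r, Q si * v = 1 + r * 'X^(k.+1).
  by apply: poly_inv_modXn; rewrite Q0 oner_eq0.
have [Vo [ro Vo1]] : exists v r, P so * v = 1 + r * 'X^(k.+1).
  by apply: poly_inv_modXn; rewrite -normr_eq0 P0.
have g'0 : g'`_0 = an by rewrite g'E // subn0.
have [W [rW W1]] : exists v r, g' * v = 1 + r * 'X^(k.+1).
  by apply: poly_inv_modXn; rewrite g'0.
have Ck : `|(P si * Vi)`_k| <= 1 - `|(P si * Vi)`_0| ^+ 2.
  apply: schur_coef_bound Vi1 => // u; apply: trunc_norm2_in.
  exact: filter_all.
have Dk : `|(Q so * Vo)`_k| <= 1 - `|(Q so * Vo)`_0| ^+ 2.
  apply: schur_coef_bound Vo1 => // u; apply: trunc_norm2_out.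
  apply/allP => z; rewrite mem_filter /= /ins => /andP[+ _].
  by rewrite -real_ltNge ?normr_real ?real1 //; apply: ltW.
have Vi0 : Vi`_0 = 1.
  move/(congr1 (fun p : {poly C} => p`_0)): Vi1.
  by rewrite coef0M Q0 mul1r coefD coefMXn coef1 /= addr0.
have Vo0 : (P so)`_0 * Vo`_0 = 1.
  move/(congr1 (fun p : {poly C} => p`_0)): Vo1.
  by rewrite coef0M coefD coefMXn coef1 /= addr0.
have W0 : an * W`_0 = 1.
  move/(congr1 (fun p : {poly C} => p`_0)): W1.
  by rewrite coef0M coefD coefMXn coef1 g'0 /= addr0.
pose h := an%:P * g - a0%:P * g'.
have [H hE H0] : exists2 H, h = H * 'X^k & H`_0 = beta.
  have hk i : (i <= k)%N -> h`_i = an * g`_i - a0 * g`_(n - i).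
    by move=> ik; rewrite coefB !coefCM g'E // (leq_trans ik).
  exists (drop_poly k h); last by rewrite coef_drop_poly add0n hk.
  rewrite -[LHS](poly_take_drop k).
  suff -> : take_poly k h = 0 by rewrite add0r.
  apply/polyP => i; rewrite coef_take_poly coef0; case: ltnP => // ik.
  rewrite hk ?(ltnW ik) //; case: i ik => [|i] ik; last by rewrite g_rec ?subrr.
  by rewrite subn0 mulrC subrr.
(* [E] is an F - a0 G up to degree k; [T] collects the errors of the two truncated inverses, which
   only enter from degree k + 1 on. *)
pose E := an%:P * (P si * Vi) - a0%:P * (Q so * Vo).
pose T := an%:P * an%:P * Q so * P si * (ri - ro).
have gP : g = an%:P * (P si * P so) by rewrite mul_polyC -PE.
have g'P : g' = an%:P * (Q si * Q so) by rewrite mul_polyC -QE.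
have g'_mulE : g' * E = (H * (Q so * Vo) + T * 'X) * 'X^k.
  have -> : (H * (Q so * Vo) + T * 'X) * 'X^k = h * (Q so * Vo)
     + an%:P * an%:P * Q so * P si *
       ((1 + ri * 'X^(k.+1)) - (1 + ro * 'X^(k.+1))).
    by rewrite hE /T exprS; ring.
  by rewrite -Vi1 -Vo1 /h /E {1}gP g'P; ring.
(* [E] recurs on the right, but only with a factor X^(k+1), so its coefficient of degree k can be
   read off. *)
have EE : E = ((H * (Q so * Vo) + T * 'X) * W - E * rW * 'X) * 'X^k.
  transitivity (g' * E * W - E * rW * 'X^(k.+1)).
    have -> : g' * E * W = E * (g' * W) by ring.
    by rewrite W1; ring.
  by rewrite g'_mulE exprS; ring.
have Ek : an * (P si * Vi)`_k - a0 * (Q so * Vo)`_k =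
    beta * (Q so * Vo)`_0 * W`_0.
  transitivity E`_k; first by rewrite coefB !coefCM.
  rewrite EE coefMXn ltnn subnn coefB coefMX /= subr0 !coef0M coefD coefMX /=.
  by rewrite addr0 !coef0M H0.
have C0 : `|(P si * Vi)`_0| = c by rewrite coef0M Vi0 mulr1 P0.
have D0 : (Q so * Vo)`_0 = Vo`_0 by rewrite coef0M Q0 mul1r.
have od1 : o * `|Vo`_0| = 1 by rewrite /o -P0 -normrM Vo0 normr1.
have aw1 : `|an| * `|W`_0| = 1 by rewrite -normrM W0 normr1.
have a0E : `|a0| = `|an| * (c * o).
  by rewrite /a0 gcoef PE coef0M !normrM !P0.
have ME : M = `|an| * o.
  rewrite /M -(perm_big _ split_s) big_cat /= !big_filter.
  rewrite big1 ?mul1r => [|z zi]; last by rewrite [`|z| <= 1]zi.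
  congr (_ * _); rewrite /o big_filter; apply: eq_bigr => z /=.
  by rewrite /ins => /negbTE ->.
have bound : `|beta| * `|Vo`_0| * `|W`_0| <=
    `|an| * (1 - c ^+ 2) + `|a0| * (1 - `|Vo`_0| ^+ 2).
  rewrite -D0 -!normrM -Ek; apply: le_trans (ler_normB _ _) _.
  by rewrite !normrM -C0 lerD // ler_wpM2l.
(* Scaling [bound] by M^2 clears the inverses: |Vo_0| = 1 / o and |W_0| = 1 / |an|. *)
have -> : `|beta| * M =
    `|beta| * `|Vo`_0| * `|W`_0| * (`|an| * o) ^+ 2.
  transitivity (`|beta| * M * (o * `|Vo`_0|) * (`|an| * `|W`_0|)).
    by rewrite od1 aw1 !mulr1.
  by rewrite ME; ring.
have -> : (`|a0| + `|an|) * (M ^+ 2 - `|a0| * `|an|) =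
    (`|an| * (1 - c ^+ 2) + `|a0| * (1 - `|Vo`_0| ^+ 2)) * (`|an| * o) ^+ 2.
  transitivity ((`|a0| + `|an|) * (M ^+ 2 - `|a0| * `|an|) +
      `|a0| * `|an| ^+ 2 * (1 - (o * `|Vo`_0|) ^+ 2)).
    by rewrite od1 expr1n subrr mulr0 addr0.
  by rewrite ME a0E; ring.
by rewrite ler_wpM2r // -ME exprn_ge0 // ME mulr_ge0 // prodr_ge0.
Qed.

Theorem theorem1 (R : realType) (f : {poly int}) (n k : nat)
    (deg_f : size f = n.+1)
    (k_gt0 : (0 < k)%N) (le_2k_n : (2 * k <= n)%N)
    (rec_f : forall i : nat, (1 <= i <= k - 1)%N ->
       f`_n * f`_i = f`_0 * f`_(n - i)) :
  let alpha : R := `|f`_k * f`_n - f`_0 * f`_(n - k)|%:~R in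
  let a0 : R := (f`_0)%:~R in
  let an : R := (f`_n)%:~R in
  (alpha + Num.sqrt (alpha ^+ 2 + 4 * (`|a0| + `|an|) ^+ 2 * `|a0 * an|))
    / (2 * (`|a0| + `|an|)) <= mahler_measure R f.
Proof.
cbv zeta; set alpha := `|f`_k * f`_n - _|%:~R.
set a0 := (f`_0)%:~R; set an := (f`_n)%:~R.
have lead : lead_coef f = f`_n by rewrite lead_coefE deg_f.
have an0 : f`_n != 0 by rewrite -lead lead_coef_eq0 -size_poly_eq0 deg_f.
pose s := complex_roots R f; pose g : {poly R[i]} := map_poly intr f.
have gE : g = (f`_n)%:~R *: \prod_(z <- s) ('X - z%:P).
  by rewrite /g complex_rootsP lead.
have gi i : g`_i = (f`_i)%:~R by rewrite coef_map.
have sn : size s = n.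
  have : size g = n.+1.
    by rewrite size_map_inj_poly ?rmorph0 //; exact: intr_inj.
  by rewrite gE size_scale ?intr_eq0 // size_prod_XsubC => -[].
have normcE (z : R[i]) : `|z| = (Normc.normc z)%:C%C.
  by rewrite normc_def; case: z.
set M := mahler_measure R f.
have ME : M%:C%C = `|(f`_n)%:~R : R[i]| *
    \prod_(z <- s) (if `|z| <= 1 then 1 else `|z|).
  rewrite /M /mahler_measure rmorphM rmorph_prod /= lead rmorph_int.
  rewrite -intr_norm; congr (_ * _); apply: eq_bigr => z _.
  rewrite normcE -(rmorph1 (real_complex R)) lecR; case: ifP => [le1|].
    by rewrite max_l.
  by move/negbT; rewrite -ltNge => /ltW le1; rewrite max_r.
have M0 : 0 < M.
  rewrite /M /mahler_measure lead mulr_gt0 ?ltr0z ?normr_gt0 //.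
  by apply: prodr_gt0 => z _; rewrite lt_max ltr01.
clearbody M.
have core : alpha * M <= (`|a0| + `|an|) * (M ^+ 2 - `|a0| * `|an|).
  rewrite -lecR !(rmorphM, rmorphB, rmorphD, rmorphXn) /= ME.
  rewrite /alpha /a0 /an -!intr_norm !rmorph_int [f`_k * _]mulrC.
  rewrite !intr_norm !(rmorphB, rmorphM) /= -!gi -sn.
  apply: mahler_quadratic_bound; rewrite ?sn //.
  - by rewrite k_gt0 (leq_trans _ le_2k_n) // leq_pmull.
  - by rewrite gi intr_eq0.
  - by rewrite gi.
  - by move=> i; rewrite gi realz.
  move=> i /andP[i0 ik]; rewrite !gi -!rmorphM /= rec_f //.
  by rewrite i0 -ltnS subn1 prednK.
have s0 : 0 < `|a0| + `|an|.
  by rewrite ltr_wpDl // normr_gt0 intr_eq0.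
rewrite normrM; move: s0 core.
set S := `|a0| + `|an|; set p := `|a0| * `|an| => s0 core.
have p0 : 0 <= p by rewrite mulr_ge0.
(* This makes 2 S M - alpha nonnegative, so that it is the square root of its square. *)
have alpha_le : alpha <= S * M.
  by rewrite -(ler_pM2r M0); nra.
rewrite ler_pdivrMr ?mulr_gt0 // -lerBrDl.
rewrite -[leRHS]ger0_norm ?subr_ge0; last by nra.
(* After expanding (2 S M - alpha)^2, what remains is [core] multiplied by 4 S. *)
rewrite -sqrtr_sqr ler_wsqrtr //; nra.
Qed.
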